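(* Let $H$ be a hypohamiltonian snark and let $x,y$ be a pair of nonadjacent vertices in $H$. Then the superedge $H_{x,y}$ is $j$-right for at least one $j\in\{1,2,3\}$.
   Context: Graphs are simple, cubic and bridgeless. A snark is a bridgeless cubic graph that is not $3$-edge-colorable. A graph $H$ is hypohamiltonian if $H$ is not Hamiltonian but $H-v$ is Hamiltonian for every $v\in V(H)$. Multipoles and normal colorings. A (cubic) multipole consists of vertices, edges (with two end-vertices) and semiedges (with one end-vertex), each vertex being incident to exactly three edges or semiedges. A proper $5$-edge-coloring of a cubic multipole assigns to edges and semiedges colors from $\{1,\ldots,5\}$ so that those incident to the same vertex get distinct colors. For a vertex $v$, $\sigma(v)$ is the set of three colors at $v$. An edge $uv$ is poor (resp. rich) if $|\sigma(u)\cup\sigma(v)|=3$ (resp. $=5$). A normal $5$-edge-coloring is a proper $5$-edge-coloring in which every edge is poor or rich (no requirement on semiedges). A Kempe $(a,b)$-chain is a path that starts and ends with a semiedge and whose (semi)edges are alternately colored $a$ and $b$. Color schemes. If $s$ is a semiedge with end-vertex $v$, its color scheme is $\sigma[s]=(a,\{b,c\})$, where $a=\sigma(s)$ and $b,c$ are the two other colors at $v$. Schemes $(a,\{b,c\})$ and $(a',\{b',c'\})$ are consistent if $a=a'$ and $\{b,c\}$ equals $\{b',c'\}$ or $\{1,2,3,4,5\}\setminus\{a',b',c'\}$. Superedges. For a snark $H$ and distinct nonadjacent vertices $x,y$ of $H$, the superedge $H_{x,y}$ is the multipole obtained from $H$ by deleting $x$ and $y$ and turning each edge incident to $x$ or $y$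 into a semiedge at its remaining end-vertex. The three semiedges coming from $x$ are the left semiedges, labelled $s_1^l,s_2^l,s_3^l$; the three coming from $y$ are the right semiedges, labelled $s_1^r,s_2^r,s_3^r$. Right superedges. A superedge is $j$-right ($j\in\{1,2,3\}$) if it has a normal $5$-edge-coloring such that: the color schemes of $s_j^l$ and of all three right semiedges are consistent with $(3,\{1,2\})$; the color schemes of the two left semiedges other than $s_j^l$ are consistent with $(2,\{1,3\})$; and there is a Kempe $(2,1)$-chain connecting these two left semiedges. *)

(* Defs.v *)
From mathcomp Require Import all_boot.

Set Implicit Arguments.
Unset Strict Implicit.
Unset Printing Implicit Defensive.

Record sgraph := SGraph {
  svertex :> finType;
  adj : rel svertex;
  adj_sym : symmetric adj;
  adj_irrefl : irreflexive adj }.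

Definition edge_set (G : sgraph) : {set {set G}} :=
  [set A : {set G} |
    [exists u : G, exists v : G, adj u v && (A == [set u; v])]].

Lemma edge_setP (G : sgraph) (A : {set G}) :
  reflect (exists u v : G, adj u v /\ A = [set u; v]) (A \in edge_set G).
Proof.
rewrite inE; apply: (iffP existsP) => [[u /existsP[v /andP[uv /eqP ->]]]|].
  by exists u, v.
by case=> u [v [uv ->]]; exists u; apply/existsP; exists v; rewrite uv eqxx.
Qed.

Definition gedge (G : sgraph) : finType := {A : {set G} | A \in edge_set G}.

Definition cubic (G : sgraph) : Prop :=
  forall v : G, #|[set u : G | adj v u]| = 3.

Definition bridge (G : sgraph) (u v : G) : bool :=
  adj u v &&
  ~~ connect [rel a b : G | adj a b && ([set a; b] != [set u; v])] u v.

Definition bridgeless (G : sgraph) : Prop := forall u v : G, ~~ bridge u v.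

Definition edge_colorable (G : sgraph) (k : nat) : Prop :=
  exists c : gedge G -> 'I_k, forall f g : gedge G,
    f != g -> ~~ [disjoint val f & val g] -> c f != c g.

Definition snark (G : sgraph) : Prop :=
  [/\ cubic G, bridgeless G & ~ edge_colorable G 3].

Definition induced (G : sgraph) (S : {set G}) : sgraph :=
  @SGraph {v : G | v \in S} (fun u v => adj (val u) (val v))
    (fun u v => adj_sym (val u) (val v)) (fun u => adj_irrefl (val u)).

Definition hamiltonian (G : sgraph) : Prop :=
  exists p : seq G, [/\ 2 < size p, ucycle (@adj G) p & forall v : G, v \in p].

Definition hypohamiltonian (G : sgraph) : Prop :=
  ~ hamiltonian G /\ forall v : G, hamiltonian (induced (~: [set v])).

(* Only the incidence structure; that each edge has two end-vertices and each
   vertex lies on exactly three edges or semiedges is the predicate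
   [cubic_multipole] below. *)
Record multipole := Multipole {
  mvertex : finType;
  medge : finType;
  msemi : finType;
  ends : medge -> {set mvertex};
  send : msemi -> mvertex }.

Section Coloring.

Variable M : multipole.

Definition link : finType := (medge M + msemi M)%type.

Definition incident (v : mvertex M) (l : link) : bool :=
  match l with inl f => v \in ends f | inr s => v == send s end.

Definition cubic_multipole : Prop :=
  (forall f : medge M, #|ends f| = 2) /\
  (forall v : mvertex M, #|[set l | incident v l]| = 3).

(* The colors 1, ..., 5 are the ordinals 0, ..., 4. *)
Definition color : finType := 'I_5.

Definition proper (c : link -> color) : Prop :=
  forall (v : mvertex M) (l l' : link),
    incident v l -> incident v l' -> l != l' -> c l != c l'.

Definition sigma (c : link -> color) (v : mvertex M) : {set color} :=
  [set c l | l in incident v].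

Definition poor (c : link -> color) (f : medge M) : bool :=
  #|\bigcup_(v in ends f) sigma c v| == 3.

Definition rich (c : link -> color) (f : medge M) : bool :=
  #|\bigcup_(v in ends f) sigma c v| == 5.

Definition normal_coloring (c : link -> color) : Prop :=
  proper c /\ forall f : medge M, poor c f || rich c f.

Definition scheme (c : link -> color) (s : msemi M) : color * {set color} :=
  (c (inr s), sigma c (send s) :\ c (inr s)).

Fixpoint walk (u : mvertex M) (p : seq (medge M * mvertex M)) : bool :=
  if p is (f, v) :: p' then (ends f == [set u; v]) && walk v p' else true.

Definition alternate (a b : color) : rel color :=
  [rel i j | (i == a) && (j == b) || (i == b) && (j == a)].

Definition kempe_chain (c : link -> color) (a b : color) (s t : msemi M) :
    Prop :=
  exists p : seq (medge M * mvertex M),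
    [/\ walk (send s) p,
        uniq (send s :: unzip2 p),
        last (send s) (unzip2 p) = send t
      & path (alternate a b) (c (inr s))
             (rcons [seq c (inl f) | f <- unzip1 p] (c (inr t)))].

End Coloring.

Definition consistent (p q : color * {set color}) : Prop :=
  p.1 = q.1 /\ (p.2 = q.2 \/ p.2 = ~: (q.1 |: q.2)).

Definition col1 : color := @Ordinal 5 0 isT.
Definition col2 : color := @Ordinal 5 1 isT.
Definition col3 : color := @Ordinal 5 2 isT.

(* [l] and [r] list the left and the right semiedges; [i] and [k] are the two
   indices other than [j]. *)
Definition j_right (M : multipole) (l r : 'I_3 -> msemi M) (j : 'I_3) : Prop :=
  exists c : link M -> color,
    [/\ normal_coloring c,
        consistent (scheme c (l j)) (col3, [set col1; col2]),
        forall i, consistent (scheme c (r i)) (col3, [set col1; col2]),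
        forall i, i != j -> consistent (scheme c (l i)) (col2, [set col1; col3])
      & exists i k : 'I_3,
          uniq [:: i; j; k] /\ kempe_chain c col2 col1 (l i) (l k)].

Section Superedge.

Variables (H : sgraph) (x y : H).

Definition remainder : sgraph := induced (~: [set x; y]).

(* A semiedge is a pair (v, z) coming from the edge vz of H with v a remaining
   vertex and z one of x, y; a common neighbor of x and y thus carries two
   semiedges. *)
Definition superedge_semi : finType :=
  {p : remainder * H | (p.2 \in [set x; y]) && adj (val p.1) p.2}.

Definition superedge : multipole :=
  @Multipole remainder (gedge remainder) superedge_semi
    (fun f => val f) (fun s => (val s).1).

Definition labels (z : H) (l : 'I_3 -> msemi superedge) : Prop :=
  injective l /\
  forall s : msemi superedge, (val s).2 = z <-> exists i, s = l i.

Lemma labels_exist (z : H) :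
  cubic H -> ~~ adj x y -> z \in [set x; y] -> exists l, labels z l.
Proof.
move=> cubH xNy z_xy.
pose S := [set s : superedge_semi | (val s).2 == z].
have nbr (v : H) : adj z v -> v \in ~: [set x; y].
  move: z_xy; rewrite !inE negb_or => /orP[]/eqP-> adjv; apply/andP; split;
    apply: contraTneq adjv => ->; rewrite ?adj_irrefl ?xNy //.
  by rewrite adj_sym xNy.
have cardS : #|S| = 3.
  rewrite -(cubH z); pose f (s : superedge_semi) := val (val s).1.
  have injf : {in S &, injective f}.
    move=> [[u a] /= pu] [[w b] /= pw]; rewrite !inE /= => /eqP az /eqP bz.
    rewrite /f /= => /val_inj uw; apply/val_inj => /=.
    by rewrite uw az bz.
  rewrite -(card_in_imset injf); apply: eq_card => v; rewrite inE.
  apply/imsetP/idP => [[[[u a] /= pu]]|adjv].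
    have /andP[_ adju] := pu.
    by rewrite inE /= => /eqP <- ->; rewrite /f /= adj_sym.
  have ps : (z \in [set x; y]) && adj v z by rewrite z_xy adj_sym.
  by exists (Sub (Sub v (nbr v adjv) : remainder, z) ps); rewrite ?inE.
exists (fun i => enum_val (cast_ord (esym cardS) i)); split.
  by move=> i k /enum_val_inj /cast_ord_inj.
move=> s; split=> [sz|[i ->]].
  have sS : s \in S by rewrite inE sz.
  exists (cast_ord cardS (enum_rank_in sS s)).
  by rewrite cast_ordK enum_rankK_in.
by have := enum_valP (cast_ord (esym cardS) i); rewrite inE => /eqP.
Qed.

Lemma superedge_cubic : cubic H -> cubic_multipole superedge.
Proof.
move=> cubH; split=> [f|v].
  have /edge_setP[u [v [/= uv ef]]] := valP f; rewrite /= ef cards2.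
  by case: eqP uv => // ->; rewrite adj_irrefl.
pose N := [set u | adj (val v) u].
pose E := [set f : gedge remainder | v \in val f].
pose S := [set s : superedge_semi | v == (val s).1].
have -> : [set l | @incident superedge v l] = (inl @: E) :|: (inr @: S).
  apply/setP => -[f|s]; rewrite !inE /=.
    rewrite mem_imset ?inE; last by move=> ? ? [].
    by rewrite (_ : _ \in inr @: S = false) ?orbF //; apply/imsetP => -[].
  rewrite orbC mem_imset ?inE; last by move=> ? ? [].
  by rewrite (_ : _ \in inl @: E = false) ?orbF //; apply/imsetP => -[].
rewrite cardsU (_ : _ :&: _ = set0) ?cards0 ?subn0; last first.
  by apply/setP => l; rewrite !inE; apply/andP => -[/imsetP[f _ ->] /imsetP[]].
rewrite !card_imset; try by move=> ? ? [].
rewrite -(cubH (val v)) -/N -(cardsID [set x; y] N) addnC; congr (_ + _).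
  have injS : {in S &, injective (fun s : superedge_semi => (val s).2)}.
    move=> [[u a] /= pu] [[w b] /= pw]; rewrite !inE /= => /eqP vu /eqP vw ab.
    by apply/val_inj; rewrite /= -vu -vw ab.
  rewrite -(card_in_imset injS); apply: eq_card => z; rewrite in_setI.
  apply/imsetP/andP => [[[[u a] /= pu]]|[]].
    have /andP[/= axy adja] := pu.
    by rewrite inE /= => /eqP vu ->; rewrite axy inE vu.
  rewrite inE => adjz zxy.
  have ps : (z \in [set x; y]) && adj (val v) z by rewrite zxy.
  by exists (Sub (v, z) ps); rewrite ?inE.
pose B := [set u : remainder | adj (val v) (val u)].
have -> : #|N :\: [set x; y]| = #|B|.
  rewrite -(card_imset _ val_inj); apply: eq_card => u; rewrite in_setD.
  apply/andP/imsetP => [[uxy]|[w]]; last first.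
    by rewrite !inE => adjw ->; have := valP w; rewrite !inE.
  rewrite inE => adju; have pu : u \in ~: [set x; y] by rewrite in_setC.
  by exists (Sub u pu : remainder); rewrite ?inE.
have injB : {in B &, injective (fun u : remainder => [set v; u])}.
  move=> u w; rewrite !inE => adju _ /setP/(_ u).
  rewrite !inE eqxx orbT => /esym/orP[]/eqP // uv.
  by rewrite uv adj_irrefl in adju.
rewrite -(card_in_imset injB) -(card_imset E val_inj); apply: eq_card => A.
apply/imsetP/imsetP => [[f]|[u]]; rewrite inE.
  move=> vf ->; have /edge_setP[a [b [/= ab ef]]] := valP f.
  have: v \in [set a; b] by rewrite -ef.
  rewrite ef !inE.
  case/orP=> /eqP va; first by exists b; rewrite ?inE va.
  exists a; first by rewrite inE va adj_sym.
  by rewrite va; apply: setUC.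
move=> adju ->.
have pA : [set v; u] \in edge_set remainder.
  by apply/edge_setP; exists v, u.
by exists (Sub [set v; u] pA : gedge remainder); rewrite ?inE ?eqxx.
Qed.

End Superedge.

(* Main.v *)
Require Import Defs.
From mathcomp Require Import all_boot.
From mathcomp Require Import zify.

Set Implicit Arguments.
Unset Strict Implicit.
Unset Printing Implicit Defensive.

(** The deletion of y leaves a graph with a Hamiltonian cycle C, and C passes
through x.  A cubic graph has even order, so C has odd length and the path
C - x has an even number of vertices.  Run along C from x back to x and color
its edges alternately 2, 1, 2, ..., 1, 2; the two edges of C at x both get 2
because the length is odd.  Every edge outside C gets 3.  In the superedge each
vertex lies on C, so it sees the two cycle colors 1 and 2 and, on its one link
outside C, the color 3.  The result is a proper coloring with the same set
{1, 2, 3} at all vertices, hence every edge is poor.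

The three right semiedges come from edges at y, which are not on C, so they
are colored 3; so is the left semiedge coming from the edge at x outside C, and
its label is the required j.  The other two left semiedges are the ends of the
path C - x, colored 2, and this path is the Kempe (2,1)-chain joining them.

The coloring is encoded through [mate b v]: the neighbor of v along the cycle
edge of color 1 (b = false) or 2 (b = true).  The symmetry of this relation
([mateK]) makes the color of an edge independent of the end it is read from;
[dart_color_inj] (properness), [ham_sigma] (all edges poor) and [ham_kempe]
(the chain) carry the rest. *)

(** * Parity and the Hamiltonian cycle *)

(** Handshaking: each edge is counted once from its lower and once from its
higher end, so the sum of the degrees, 3 |V|, is even. *)
Lemma cubic_even_order (G : sgraph) : cubic G -> ~~ odd #|G|.
Proof.
move=> cubG.
pose below := [rel u v : G | adj u v && (enum_rank u < enum_rank v)].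
pose d := \sum_(u : G) \sum_(v : G) below u v.
have : \sum_(u : G) \sum_(v : G) adj u v = d + d.
  have dE : d = \sum_(u : G) \sum_(v : G) below v u by exact: exchange_big.
  rewrite {2}dE -big_split; apply: eq_bigr => u _ /=.
  rewrite -big_split; apply: eq_bigr => v _ /=.
  rewrite [adj v u]adj_sym; case uv: (adj u v) => //=.
  have : enum_rank u != enum_rank v.
    by apply: contraTneq uv => /enum_rank_inj ->; rewrite adj_irrefl.
  by rewrite -val_eqE /=; case: ltngtP.
have -> : \sum_(u : G) \sum_(v : G) adj u v = #|G| * 3.
  rewrite -sum_nat_const; apply: eq_bigr => u _.
  rewrite -(cubG u) -sum1_card [RHS]big_mkcond; apply: eq_bigr => v _.
  by rewrite inE; case: adj.
by move/(congr1 odd); rewrite oddM oddD addbb andbT => ->.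
Qed.

(** The Hamiltonian cycle of G - y, read in G and cut open at x. *)
Lemma induced_cycle (G : sgraph) (x y : G) :
  x != y -> hamiltonian (induced (~: [set y])) ->
  exists p : seq G, [/\ cycle (@adj G) (x :: p), uniq (x :: p),
    forall v, (v \in x :: p) = (v != y) & 1 < size p].
Proof.
move=> xDy [q [q2 /andP[cq uq] allq]].
pose q' := [seq val v | v <- q].
have memq v : (v \in q') = (v != y).
  apply/mapP/idP => [[w _ ->]|vy]; first by have := valP w; rewrite !inE.
  have pv : v \in ~: [set y] by rewrite !inE.
  by exists (Sub v pv : induced (~: [set y])); rewrite ?allq.
have cq' : cycle (@adj G) q' by rewrite /q' cycle_map.
have uq' : uniq q' by rewrite map_inj_uniq //; exact: val_inj.
have xq : x \in q' by rewrite memq.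
have [i p qE] := rot_to xq; exists p; rewrite -qE rot_cycle rot_uniq; split=> //.
  by move=> v; rewrite mem_rot.
by rewrite -ltnS -[(size p).+1]/(size (x :: p)) -qE size_rot size_map.
Qed.

(** * Mates along the cycle *)

Section HamiltonianColoring.

Variables (H : sgraph) (x y : H) (p : seq H).
Hypotheses (cubH : cubic H) (cyc : cycle (@adj H) (x :: p)).
Hypothesis uniq_xp : uniq (x :: p).
Hypotheses (mem_xp : forall v, (v \in x :: p) = (v != y)).
Hypotheses (even_p : ~~ odd (size p)) (p_gt1 : 1 < size p).

Let R := remainder x y.
Let at_ k := nth x (x :: p) k.
Let pos v := index v (x :: p).

(** The cycle positions are 0 for x and 1, ..., size p for the vertices of the
superedge.  The default x of nth makes position (size p).+1 denote x again, so
the edge that closes the cycle needs no separate treatment. *)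
Definition step (b : bool) (k : nat) := if odd k (+) b then k.+1 else k.-1.

Definition mate (b : bool) (v : H) : H :=
  nth x (x :: p) (step b (index v (x :: p))).

(** The color of the link that goes from v towards w, where v is a vertex of the
superedge and w any vertex of H, possibly x or y. *)
Definition dart_color (v w : H) : color :=
  if w == mate false v then col1 else if w == mate true v then col2 else col3.

Lemma at_adj k : k <= size p -> adj (at_ k) (at_ k.+1).
Proof.
move=> kp; have /(pathP x)/(_ k) := cyc; rewrite size_rcons ltnS => /(_ kp).
rewrite -rcons_cons nth_rcons /= ltnS kp /at_ /=.
rewrite nth_rcons; case: ltngtP kp => //= -> _.
by rewrite [nth x p (size p)]nth_default.
Qed.

Lemma pos_at k : k <= size p -> pos (at_ k) = k.
Proof. by move=> kp; rewrite /pos /at_ index_uniq. Qed.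

Lemma at_end : at_ (size p).+1 = x. Proof. by rewrite /at_ nth_default. Qed.

Lemma remainder_pos (v : R) :
  exists2 k, 0 < k <= size p & val v = at_ k.
Proof.
have := valP v; rewrite !inE negb_or => /andP[vx vy].
have vq : val v \in x :: p by rewrite mem_xp.
exists (pos (val v)); last by rewrite /at_ nth_index.
have : pos (val v) < (size p).+1 by rewrite -[ltnRHS]/(size (x :: p)) index_mem.
by rewrite ltnS => ->; rewrite andbT /pos /= eq_sym (negPf vx).
Qed.

Lemma mate_at b k : k <= size p -> mate b (at_ k) = at_ (step b k).
Proof. by move=> kp; rewrite /mate -/(pos _) pos_at. Qed.

Lemma mate_adj b (v : R) : adj (val v) (mate b (val v)).
Proof.
have [k /andP[k0 kp] ->] := remainder_pos v; rewrite mate_at //.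
rewrite /step; case: ifP => _; first exact: at_adj.
by rewrite adj_sym -{2}(prednK k0); apply: at_adj; lia.
Qed.

(** The bound on k' reaches the second name (size p).+1 of x; it is harmless
because k is the position of a vertex other than x. *)
Lemma at_eq k k' : 0 < k <= size p -> k' <= (size p).+1 -> at_ k = at_ k' -> k = k'.
Proof.
move=> kp; rewrite leq_eqVlt => /orP[/eqP->|k'p /(congr1 pos)].
  by rewrite at_end -[x]/(at_ 0) => /(congr1 pos); rewrite !pos_at; lia.
by rewrite !pos_at; lia.
Qed.

(** The two mates of v are at the positions before and after it, and these could
only coincide on a cycle of length two; the cycle here is longer. *)
Lemma mate_neq (v : R) : mate false (val v) != mate true (val v).
Proof.
have [k kp ->] := remainder_pos v; rewrite !mate_at; [|lia..].
apply/eqP => /at_eq; rewrite /step.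
by case: ifP; case: ifP; lia.
Qed.

(** The parity of the position of a vertex decides whether its mate comes after
or before it, and neighboring positions have opposite parities; so an edge of
the cycle gets the same color from both ends. *)
Lemma mateK b (v w : R) : val w = mate b (val v) -> val v = mate b (val w).
Proof.
have [k kp ->] := remainder_pos v; have [k' kp' ->] := remainder_pos w.
rewrite !mate_at; [|lia..] => /at_eq e.
have {}e : k' = step b k by apply: e => //; rewrite /step; case: ifP; lia.
congr at_; rewrite e /step; case: b {e}; case: ifP; case: ifP; lia.
Qed.

Lemma mate_neq_y b (v : R) : mate b (val v) != y.
Proof.
have [k kp ->] := remainder_pos v; rewrite mate_at; last lia.
rewrite -mem_xp; have [sp|sp] := ltnP (step b k) (size p).+1.
  exact: mem_nth.
by rewrite /at_ nth_default // mem_head.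
Qed.

(** Both edges of the cycle at x have color 2, the last one because size p is
even. *)
Lemma mate_eq_x b (v : R) :
  (mate b (val v) == x) = b && ((val v == at_ 1) || (val v == at_ (size p))).
Proof.
have [k kp ->] := remainder_pos v; rewrite mate_at; last lia.
apply/eqP/idP => [e|/andP[-> /orP[]/eqP/at_eq ->]]; rewrite ?/step //=; try lia; last first.
  by rewrite (negPf even_p) at_end.
have : step b k = 0 \/ step b k = (size p).+1.
  have [sp|sp] := ltnP (step b k) (size p).+1.
    by left; have := pos_at sp; rewrite e /pos index_head.
  by right; move: sp; rewrite /step; case: ifP; lia.
rewrite /step; case: b {e}; case: ifP => ob [] e; try lia.
  by rewrite (_ : k = size p) ?eqxx ?orbT //; lia.
by rewrite (_ : k = 1) ?eqxx //; lia.
Qed.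

(** * The coloring of the superedge *)

(** l is the link of v that comes from the edge vw of H; this treats edges and
semiedges alike. *)
Definition joins (v : R) (w : H) (l : link (superedge x y)) : bool :=
  match l with
  | inl f => val @: val f == [set val v; w]
  | inr s => ((val s).1 == v) && ((val s).2 == w)
  end.

Lemma incident_joins (v : R) l :
  @incident (superedge x y) v l -> exists2 w, adj (val v) w & joins v w l.
Proof.
case: l => [f|s] /=.
  have /edge_setP[a [b [/= ab ->]]] := valP f.
  rewrite !inE => /orP[]/eqP->; [exists (val b) | exists (val a)] => //.
  - by rewrite imsetU1 imset_set1.
  - by rewrite adj_sym.
  - by rewrite imsetU1 imset_set1 [eqbRHS]setUC.
move/eqP=> ->; exists (val s).2; last by rewrite !eqxx.
by have /andP[] := valP s.
Qed.

Lemma joins_inj v w l l' : joins v w l -> joins v w l' -> l = l'.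
Proof.
have mixed f s : joins v w (inl f) -> joins v w (inr s) -> False.
  move=> /= /eqP e /andP[_ /eqP sw]; have /andP[wxy _] := valP s.
  have : w \in val @: val f by rewrite e !inE eqxx orbT.
  by case/imsetP=> u _ wu; have := valP u; rewrite inE -wu -sw wxy.
case: l l' => [f|s] [f'|s'] j j'; try by case: (mixed _ _ j j') || case: (mixed _ _ j' j).
  congr inl; apply/val_inj/(imset_inj val_inj).
  by rewrite (eqP j) (eqP j').
congr inr; apply/val_inj; move: j j' => /= /andP[/eqP a /eqP b] /andP[/eqP c /eqP d].
by rewrite [LHS]surjective_pairing [RHS]surjective_pairing a b c d.
Qed.

Definition mated (b : bool) (f : gedge R) :=
  [exists v in val f, exists w in val f, val w == mate b (val v)].

Definition ham_coloring (l : link (superedge x y)) : color :=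
  match l with
  | inl f => if mated false f then col1 else if mated true f then col2 else col3
  | inr s => dart_color (val (val s).1) (val s).2
  end.

Lemma mated_joins b f (v w : R) :
  val f = [set v; w] -> mated b f = (val w == mate b (val v)).
Proof.
move=> e; apply/exists_inP/idP => [[a]|vw]; last first.
  exists v; first by rewrite e !inE eqxx.
  by apply/exists_inP; exists w; rewrite // e !inE eqxx orbT.
rewrite e => av /exists_inP[c cv]; move: av cv; rewrite !inE.
have nofix (u : R) : val u == mate b (val u) -> val w == mate b (val v).
  by move/eqP=> uu; have := mate_adj b u; rewrite -uu adj_irrefl.
case/orP=> /eqP-> /orP[]/eqP-> //; try exact: nofix.
by move/eqP/mateK=> {1}->.
Qed.

Lemma joins_color v w l : joins v w l -> ham_coloring l = dart_color (val v) w.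
Proof.
case: l => [f|s] /=; last by case/andP=> /eqP-> /eqP->.
move/eqP=> e; have : w \in val @: val f by rewrite e !inE eqxx orbT.
case/imsetP=> u _ wu; have fE : val f = [set v; u].
  by apply: (imset_inj val_inj); rewrite e wu imsetU1 imset_set1.
by rewrite !(mated_joins _ fE) /dart_color -wu.
Qed.

(** Besides its two distinct mates, v has only one neighbor, so color 3 cannot
be repeated. *)
Lemma dart_color_inj (v : R) w w' :
  adj (val v) w -> adj (val v) w' -> dart_color (val v) w = dart_color (val v) w' ->
  w = w'.
Proof.
move=> vw vw'; rewrite /dart_color.
case: (eqVneq w (mate false _)) => [->|w1];
  case: (eqVneq w' (mate false _)) => [->|w1'] //; try by case: ifP.
case: (eqVneq w (mate true _)) => [->|w2];
  case: (eqVneq w' (mate true _)) => [->|w2'] // _.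
apply/eqP; apply: contraT => ww'.
have uniq4 : uniq [:: mate false (val v); mate true (val v); w; w'].
  rewrite /= !inE !negb_or mate_neq ww' /=.
  by rewrite eq_sym w1 eq_sym w1' eq_sym w2 eq_sym w2'.
have := uniq_leq_size (s2 := enum [set u | adj (val v) u]) uniq4.
rewrite -cardE cubH; apply => u; rewrite mem_enum !inE.
by case/or4P=> /eqP-> //; apply: mate_adj.
Qed.

Lemma ham_coloring_proper : Defs.proper ham_coloring.
Proof.
move=> v l l' /incident_joins[w vw jl] /incident_joins[w' vw' jl'].
apply: contraNneq; rewrite (joins_color jl) (joins_color jl') => e.
move: jl'; rewrite -(dart_color_inj vw vw' e) => jl'.
by apply/eqP; exact: joins_inj jl jl'.
Qed.

Lemma card_col123 : #|[set col1; col2; col3]| = 3.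
Proof. by rewrite setUC cardsU1 cards2 !inE. Qed.

(** Three links with distinct colors taken from {1, 2, 3} exhaust this set. *)
Lemma ham_sigma v : sigma ham_coloring v = [set col1; col2; col3].
Proof.
apply/eqP; rewrite eqEcard; apply/andP; split.
  apply/subsetP => i /imsetP[l _ ->]; rewrite !inE.
  by case: l => [f|s] /=; rewrite ?/dart_color; do 2?case: ifP.
rewrite /sigma card_in_imset; last first.
  move=> l l' il il' e; apply/eqP; apply: contraPT (e) => ll'.
  by apply/eqP; apply: ham_coloring_proper il il' ll'.
have [_ /(_ v)] := superedge_cubic x y cubH.
by rewrite cardsE => ->; rewrite card_col123.
Qed.

Lemma ham_coloring_normal : normal_coloring ham_coloring.
Proof.
split=> [|f]; first exact: ham_coloring_proper.
rewrite /poor (_ : \bigcup_(v in _) _ = [set col1; col2; col3]).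
  by rewrite card_col123.
rewrite (eq_bigr (fun=> [set col1; col2; col3])); last by move=> v _; exact: ham_sigma.
have [e2 _] := superedge_cubic x y cubH.
have /card_gt0P[v vf] : 0 < #|@ends (superedge x y) f| by rewrite e2.
by apply/eqP; rewrite eqEsubset (bigcup_sup v) // andbT; apply/bigcupsP.
Qed.

Lemma ham_scheme3 s :
  ham_coloring (inr s) = col3 ->
  consistent (scheme ham_coloring s) (col3, [set col1; col2]).
Proof.
move=> c3; rewrite /scheme c3 ham_sigma; split=> //; left.
by apply/setP => i; rewrite !inE; case: (eqVneq i col3) => [->|] //=; rewrite orbF.
Qed.

Lemma ham_scheme2 s :
  ham_coloring (inr s) = col2 ->
  consistent (scheme ham_coloring s) (col2, [set col1; col3]).
Proof.
move=> c2; rewrite /scheme c2 ham_sigma; split=> //; left.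
by apply/setP => i; rewrite !inE; case: (eqVneq i col2) => [->|] //=; rewrite orbF.
Qed.

(** * The Kempe chain *)

Lemma path_walk (u : R) t :
  path (@adj R) u t ->
  exists w : seq (medge (superedge x y) * R),
    [/\ walk (M := superedge x y) u w, unzip2 w = t &
        [seq ham_coloring (inl f) | f <- unzip1 w]
          = pairmap dart_color (val u) [seq val v | v <- t]].
Proof.
elim: t u => [|v t IH] u /=; first by exists [::].
case/andP=> uv /IH[w [ww tw cw]].
have pe : [set u; v] \in edge_set R by apply/edge_setP; exists u, v.
pose f : gedge R := Sub [set u; v] pe.
exists ((f, v) :: w); split=> /=; rewrite ?eqxx ?tw //.
congr cons => //; rewrite -[LHS]/(ham_coloring (inl f)); apply: joins_color.
by rewrite /= imsetU1 imset_set1.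
Qed.

(** The color of the cycle edge between positions k and k + 1. *)
Definition turn k := if odd k then col1 else col2.

Lemma dart_color_at k :
  0 < k < size p -> dart_color (at_ k) (at_ k.+1) = turn k.
Proof.
move=> kp; rewrite /dart_color !mate_at; [|lia..].
rewrite /turn /step addbF addbT; case ok: (odd k); rewrite /= eqxx //.
by case: eqP => // /at_eq; lia.
Qed.

Lemma turn_path k n :
  path (alternate col2 col1) (turn k) [seq turn i | i <- iota k.+1 n].
Proof.
elim: n k => //= n IH k; rewrite IH andbT /turn /=.
by case: (odd k).
Qed.

Lemma dart_color_x (v : R) :
  dart_color (val v) x =
  if (val v == at_ 1) || (val v == at_ (size p)) then col2 else col3.
Proof. by rewrite /dart_color ![x == _]eq_sym !mate_eq_x. Qed.

Lemma dart_color_y (v : R) : dart_color (val v) y = col3.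
Proof. by rewrite /dart_color ![y == _]eq_sym !(negPf (mate_neq_y _ _)). Qed.

(** Along the path C - x the colors of the first semiedge, of the edges and of
the last semiedge are turn 0, turn 1, ..., turn (size p). *)
Lemma ham_kempe (s t : msemi (superedge x y)) :
  val (val s).1 = at_ 1 -> (val s).2 = x ->
  val (val t).1 = at_ (size p) -> (val t).2 = x ->
  kempe_chain ham_coloring col2 col1 s t.
Proof.
move=> s1 s2 t1 t2.
have [q pE] : exists q : seq R, p = [seq val v | v <- (val s).1 :: q].
  have sub v : v \in p -> v \in ~: [set x; y].
    move=> vp; rewrite !inE negb_or -mem_xp inE vp orbT andbT.
    by apply: contraTneq vp => ->; case/andP: uniq_xp.
  have : [seq val v | v <- pmap (insub : H -> option R) p] = p.
    rewrite (pmap_filter (@insubK _ _ _)); apply/all_filterP/allP => v /sub pv.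
    by rewrite /= insubT.
  case: pmap => [|v q] qE; first by move: p_gt1; rewrite -qE.
  exists q; rewrite -qE /=; congr (_ :: _).
  by rewrite s1 /at_ -qE.
have szp : size p = (size q).+1 by rewrite pE size_map.
have : path (@adj R) (val s).1 q.
  move: cyc; rewrite pE /= rcons_path => /and3P[_ + _].
  by rewrite path_map.
case/path_walk=> w [ww wq wc]; exists w; split; rewrite ?wq //.
- have := uniq_xp; rewrite pE cons_uniq => /andP[_].
  by rewrite (map_inj_uniq val_inj).
- apply: val_inj; rewrite /= t1 -last_map.
  by rewrite [RHS](nth_last x (x :: p)) pE.
rewrite wc (_ : pairmap _ _ _ = [seq turn i | i <- iota 1 (size q)]).
  have -> : ham_coloring (inr t) = turn (size q).+1.
    rewrite -szp /turn (negPf even_p) /= t2 dart_color_x t1.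
    by rewrite eqxx orbT.
  have -> : ham_coloring (inr s) = turn 0 by rewrite /= s2 dart_color_x s1 eqxx.
  rewrite -map_rcons -cats1 -[[:: _]]/(iota (1 + size q) 1) -iotaD.
  exact: turn_path.
apply: (@eq_from_nth _ col1); first by rewrite size_pairmap !size_map size_iota.
move=> i; rewrite size_pairmap size_map => iq.
rewrite (nth_pairmap x) ?size_map // (nth_map 0) ?size_iota // nth_iota //.
by rewrite -dart_color_at ?szp ?ltnS //= /at_ pE.
Qed.

(** * The labels of the semiedges *)

Lemma semi_x k :
  0 < k <= size p -> adj (at_ k) x ->
  exists s : msemi (superedge x y), val (val s).1 = at_ k /\ (val s).2 = x.
Proof.
move=> kp kx; have pv : at_ k \in ~: [set x; y].
  rewrite !inE negb_or -mem_xp mem_nth; last by rewrite /=; lia.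
  by rewrite andbT; apply/eqP => /(@at_eq k 0); lia.
have ps : (x \in [set x; y]) && adj (at_ k) x by rewrite !inE eqxx.
by exists (Sub (Sub (at_ k) pv : R, x) ps).
Qed.

(** The labels i and k are those of the two cycle edges at x, and j is the
remaining one. *)
Lemma ham_j_right (l r : 'I_3 -> msemi (superedge x y)) :
  labels x l -> labels y r -> exists j, j_right l r j.
Proof.
move=> [l_inj lx] [_ ry].
have [s1 [s1v s1x]] : exists s : msemi (superedge x y),
    val (val s).1 = at_ 1 /\ (val s).2 = x.
  by apply: semi_x; [lia | rewrite adj_sym; apply: (@at_adj 0)].
have [sm [smv smx]] : exists s : msemi (superedge x y),
    val (val s).1 = at_ (size p) /\ (val s).2 = x.
  by apply: semi_x; [lia | rewrite -at_end; apply: at_adj].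
have [i iE] := (lx s1).1 s1x; have [k kE] := (lx sm).1 smx.
have ik : i != k.
  apply: contraTneq p_gt1 => ik; have : at_ 1 = at_ (size p).
    by rewrite -s1v -smv iE kE ik.
  by move/at_eq; lia.
have lE i' : (val (l i')).2 = x by apply/lx; exists i'.
have rE i' : (val (r i')).2 = y by apply/ry; exists i'.
have lv a b : (val (l a)).1 = (val (l b)).1 -> a = b.
  move=> e; apply: l_inj; apply: val_inj.
  by rewrite [LHS]surjective_pairing [RHS]surjective_pairing e !lE.
have [j jik] : exists j, j \notin [:: i; k].
  apply/existsP; apply: contraT; rewrite negb_exists => /forallP all_ik.
  have := uniq_leq_size (s2 := [:: i; k]) (enum_uniq 'I_3).
  by rewrite -cardE card_ord; apply=> a _; have := all_ik a; rewrite negbK.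
have only_j a : a \notin [:: i; k] -> a = j.
  move=> aik; apply/eqP; apply: contraT => aj.
  have /card_uniqP : uniq [:: a; j; i; k].
    by rewrite !cons_uniq jik in_cons negb_or aj aik inE ik.
  by move=> e; have := max_card (mem [:: a; j; i; k]); rewrite e card_ord.
move: jik; rewrite !inE negb_or => /andP[ji jk].
exists j, ham_coloring; split.
- exact: ham_coloring_normal.
- apply: ham_scheme3; rewrite /= lE dart_color_x; case: ifP => //.
  rewrite -s1v -smv !(inj_eq val_inj) iE kE.
  case/orP=> /eqP/lv/eqP; first by rewrite (negPf ji).
  by rewrite (negPf jk).
- by move=> i'; apply: ham_scheme3; rewrite /= rE dart_color_y.
- move=> i' i'j; apply: ham_scheme2; rewrite /= lE dart_color_x.
  have : i' \in [:: i; k] by apply: contraT => /only_j ij; rewrite ij eqxx in i'j.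
  by rewrite !inE => /orP[]/eqP->; rewrite -?iE -?kE ?s1v ?smv eqxx ?orbT.
exists i, k; split; first by rewrite /= !inE negb_or ik eq_sym ji jk.
by apply: ham_kempe; rewrite -?iE -?kE.
Qed.

End HamiltonianColoring.

Theorem proposition12 (H : sgraph) (snarkH : snark H)
    (hypoH : hypohamiltonian H) (x y : H) (xDy : x != y) (xNy : ~~ adj x y)
    (l r : 'I_3 -> msemi (superedge x y))
    (hl : labels x l) (hr : labels y r) :
  exists j : 'I_3, j_right l r j.
Proof.
have [cubH _ _] := snarkH; have [_ /(_ y)] := hypoH.
case/(induced_cycle xDy)=> p [cyc uniq_xp mem_xp p_gt1].
have even_p : ~~ odd (size p).
  have szp : size (x :: p) = #|predC1 y|.
    by rewrite -(card_uniqP uniq_xp); apply: eq_card => v; rewrite mem_xp inE.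
  have H0 : 0 < #|H| by apply/card_gt0P; exists y.
  have := cubic_even_order cubH.
  by rewrite -(prednK H0) -(cardC1 y) -szp /= negbK.
exact: (ham_j_right cubH cyc uniq_xp mem_xp).
Qed.
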